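(* Let $H$ be a nonzero separable complex Hilbert space. Then the set $$\{T\in\mathcal{B}(H):\ \sigma_p(T)=\emptyset\}$$ is nowhere dense in $\mathcal{B}(H)$ with respect to the operator norm topology.
   Context: $\mathcal{B}(H)$ is the algebra of bounded linear operators on $H$. The point spectrum $\sigma_p(T)$ is the set of all $\lambda\in\mathbb{C}$ such that $\ker(T-\lambda\,\mathrm{id}_H)\neq\{0\}$. $H$ may be finite or infinite dimensional. *)

(* Defs.v *)
From HB Require Import structures.
From mathcomp Require Export all_boot all_order all_algebra.
From mathcomp Require Export sesquilinear.
From mathcomp Require Export complex.
From mathcomp Require Export all_classical all_reals all_analysis.

Set Implicit Arguments.
Unset Strict Implicit.
Unset Printing Implicit Defensive.
Export Order.TTheory GRing.Theory Num.Theory.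
Export numFieldNormedType.Exports.

Global Open Scope classical_set_scope.
Global Open Scope ring_scope.
Global Open Scope complex_scope.

Definition nowhere_dense (T : topologicalType) (A : set T) : Prop :=
  (closure A)° = set0.

Definition separable (T : topologicalType) : Prop :=
  exists2 D : set T, countable D & dense D.

Section BoundedOperators.
Context (R : realType) (H : normedModType R[i]).

Definition bounded_op_pred : {pred H -> H} :=
  [pred f : H -> H |
    `[< linear f /\ exists M : R[i], forall x, `|f x| <= M * `|x| >]].

Record bounded_op := BoundedOp {
  bounded_op_fun :> H -> H;
  _ : bounded_op_fun \in bounded_op_pred }.

HB.instance Definition _ := [isSub for bounded_op_fun].
HB.instance Definition _ := [Choice of bounded_op by <:].

Lemma bounded_opP (f : H -> H) : reflect
  (linear f /\ exists M : R[i], forall x, `|f x| <= M * `|x|)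
  (f \in bounded_op_pred).
Proof. exact: asboolP. Qed.

Lemma bounded_op_linear (T : bounded_op) : linear T.
Proof. by have /bounded_opP[] := valP T. Qed.

HB.instance Definition _ (T : bounded_op) :=
  GRing.isLinear.Build R[i] H H *:%R T (@bounded_op_linear T).

Lemma bounded_op_bounded (T : bounded_op) :
  exists M : R[i], forall x, `|T x| <= M * `|x|.
Proof. by have /bounded_opP[] := valP T. Qed.

Lemma bounded_op_submod : submod_closed bounded_op_pred.
Proof.
split.
  apply/bounded_opP; split=> [a x y|]; first by rewrite /= scaler0 addr0.
  by exists 0 => x; rewrite normr0 mul0r.
move=> a f g /bounded_opP[lf [M fM]] /bounded_opP[lg [N gN]].
apply/bounded_opP; split=> [b x y|].
  rewrite !fctE /= lf lg !scalerDr !scalerA [a * b]mulrC addrACA.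
  by [].
exists (`|a| * M + N) => x; rewrite !fctE /=.
rewrite (le_trans (ler_normD _ _))// mulrDl lerD// normrZ -mulrA.
by rewrite ler_wpM2l.
Qed.

HB.instance Definition _ :=
  GRing.isSubmodClosed.Build R[i] (H -> H) bounded_op_pred bounded_op_submod.
HB.instance Definition _ :=
  [SubChoice_isSubLmodule of bounded_op by <:].

Lemma bounded_opD (S T : bounded_op) x : (S + T) x = S x + T x.
Proof. by []. Qed.

Lemma bounded_opZ a (T : bounded_op) x : (a *: T) x = a *: T x.
Proof. by []. Qed.

Lemma id_bounded_op : @idfun H \in bounded_op_pred.
Proof.
by apply/bounded_opP; split=> [//|]; exists 1 => x; rewrite mul1r.
Qed.

Definition id_op : bounded_op := BoundedOp id_bounded_op.

(* Norms on H take values in R[i]; they are nonnegative reals, and [complex.Re]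
   reads them back in R, where suprema are available. *)
Definition op_norm (T : bounded_op) : R[i] :=
  (sup [set complex.Re `|T x| | x in [set x | `|x| <= 1]])%:C.

Local Lemma Re_ge0K (z : R[i]) : 0 <= z -> (complex.Re z)%:C = z.
Proof. by move=> /ger0_real /RRe_real. Qed.

Local Lemma Re_normK (x : H) : (complex.Re `|x|)%:C = `|x|.
Proof. exact: Re_ge0K. Qed.

Local Lemma op_norm_has_sup (T : bounded_op) :
  has_sup [set complex.Re `|T x| | x in [set x | `|x| <= 1]].
Proof.
split; first by exists (complex.Re `|T 0|), 0 => //=; rewrite normr0.
have [M TM] := bounded_op_bounded T.
exists (complex.Re `|M|) => _ [x x1 <-].
rewrite -lecR Re_normK Re_ge0K//.
rewrite (le_trans (TM x))// -[leLHS]ger0_norm ?(le_trans _ (TM x))//.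
by rewrite normrM normr_id ler_piMr.
Qed.

Lemma op_norm_ub (T : bounded_op) x : `|x| <= 1 -> `|T x| <= op_norm T.
Proof.
move=> x1; rewrite -Re_normK lecR.
by apply: sup_upper_bound; [exact: op_norm_has_sup|exists x].
Qed.

Lemma op_norm_le (T : bounded_op) (M : R[i]) :
  (forall x, `|x| <= 1 -> `|T x| <= M) -> op_norm T <= M.
Proof.
move=> TM; have M0 : 0 <= M by apply: le_trans (TM 0 _); rewrite ?normr0.
rewrite -[M]Re_ge0K// lecR; apply: ge_sup.
  by case: (op_norm_has_sup T).
move=> _ [x /= x1 <-]; rewrite -lecR Re_normK Re_ge0K//.
exact: TM.
Qed.

Lemma op_norm_ge0 (T : bounded_op) : 0 <= op_norm T.
Proof. by apply: le_trans (@op_norm_ub T 0 _); rewrite ?normr0. Qed.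

Lemma op_norm_bound (T : bounded_op) x : `|T x| <= op_norm T * `|x|.
Proof.
have [->|x0] := eqVneq x 0; first by rewrite linear0 !normr0 mulr0.
rewrite -ler_pdivrMr ?normr_gt0// mulrC.
have nx : `| `|x|^-1| = `|x|^-1 by rewrite ger0_norm ?invr_ge0.
rewrite -[X in X * _]nx -normrZ -linearZ op_norm_ub// normrZ nx.
by rewrite mulVf ?normr_eq0.
Qed.

Local Lemma op_normD (S T : bounded_op) :
  op_norm (S + T) <= op_norm S + op_norm T.
Proof.
apply: op_norm_le => x x1; rewrite bounded_opD (le_trans (ler_normD _ _))//.
by rewrite lerD// op_norm_ub.
Qed.

Local Lemma op_normZ (a : R[i]) (T : bounded_op) :
  op_norm (a *: T) = `|a| * op_norm T.
Proof.
have leZ b (S : bounded_op) : op_norm (b *: S) <= `|b| * op_norm S.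
  apply: op_norm_le => x x1; rewrite bounded_opZ normrZ ler_wpM2l//.
  exact: op_norm_ub.
apply/eqP; rewrite eq_le leZ /=.
have [->|a0] := eqVneq a 0; first by rewrite normr0 mul0r op_norm_ge0.
rewrite -ler_pdivlMl ?normr_gt0// -normfV.
by apply: le_trans (leZ _ _); rewrite scalerA mulVf// scale1r.
Qed.

Local Lemma op_norm_eq0 (T : bounded_op) : op_norm T = 0 -> T = 0.
Proof.
move=> T0; apply: val_inj; apply/funext => x /=; apply/eqP.
by rewrite -normr_le0 (le_trans (op_norm_bound T x))// T0 mul0r.
Qed.

HB.instance Definition _ :=
  Lmodule_isNormed.Build R[i] bounded_op op_normD op_normZ op_norm_eq0.

Lemma op_normE (T : bounded_op) : `|T| = op_norm T.
Proof. by []. Qed.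

Definition point_spectrum (T : bounded_op) : set R[i] :=
  [set l | (T - l *: id_op) @^-1` [set 0] <> [set 0]].

Lemma point_spectrumP (T : bounded_op) (l : R[i]) :
  point_spectrum T l <-> exists2 x : H, x != 0 & T x = l *: x.
Proof.
split=> [kerN0|[x x0 Tx] ker0]; last first.
  move: x0; suff : [set 0 : H] x by move=> ->; rewrite eqxx.
  rewrite -ker0 /=; change (T x - l *: x = 0).
  by rewrite Tx subrr.
apply: contrapT => noeig; apply: kerN0; apply/seteqP; split=> [x Tx|_ ->] /=.
  apply/eqP/negP => /negP x0; apply: noeig; exists x => //.
  by apply/eqP; rewrite -subr_eq0; apply/eqP; exact: Tx.
exact: (linear0 (T - l *: id_op)).
Qed.

End BoundedOperators.

(* Main.v *)
From HB Require Import structures.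
Require Import Defs.
From mathcomp Require Import ring lra.

(** The operators with an eigenvalue that survives all small perturbations are
    dense, and this is the claim. In finite dimension every operator has an
    eigenvalue ([finite_dim_eigenvector]).

    In infinite dimension, let [e > 0]. Some [l] is such that [A = T - l] is not
    bounded below by [e] on any subspace of finite codimension
    ([ess_ap_eigen_exists]). This is a form of the nonemptiness of the essential
    spectrum. It is proved by an averaging argument that needs only lower
    bounds: if all the [T - l] were bounded below by [e], the quantity
    [c y (1 - c y)^-2], for [y = T ^ (2 ^ m)], would have a bound, uniform in [c],
    that is halved each time [m] increases ([square_dominated_sq]), and this
    would keep [c y] small for all [c] ([square_dominated_double]).

    Hence there is an orthonormal sequence [u] on whose closed span [A] has norm
    at most [e] ([singular_sequence]). As [H] is separable, there is an isometry
    [S] from all of [H] into the closed span of [u 1, u 2, ...], with a left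
    inverse [W] of norm at most one such that [W S = 1] ([transport_exists]
    applied to [u] and to a system from [complete_orthogonal_system]).
    Replacing [A] by [A - A S W + e W] moves it by at most [2 e] and gives an
    operator [A'] with [A' S = e]. So [A'] is onto; and it is not injective,
    since [S] is not onto: its range misses [u 0]. Both facts persist near [A']
    because [e] plus an operator of norm less than [e] is onto
    ([contraction_onto], [kernel_of_almost_right_inverse]). So [l] is an
    eigenvalue of every operator close to [A' + l]. *)

Set Implicit Arguments.
Unset Strict Implicit.
Unset Printing Implicit Defensive.

(** * Real-valued norms *)

Section RealNorm.
Context (R : realType).

Lemma Re_ge0K (z : R[i]) : 0 <= z -> (complex.Re z)%:C = z.
Proof. by move=> /ger0_real/RRe_real. Qed.

(** Norms here take values in [R[i]], whose order is partial; reading them in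
    [R] makes real arithmetic available. The absolute value of a scalar [c] is
    [nrm (c : R[i]^o)]. *)
Definition nrm (V : normedModType R[i]) (x : V) : R := complex.Re `|x|.

Section NormedModule.
Context (V : normedModType R[i]).
Implicit Types x y : V.

Lemma nrmE x : `|x| = (nrm x)%:C.
Proof. by symmetry; exact: Re_ge0K. Qed.

Lemma nrm_ge0 x : 0 <= nrm x.
Proof. by rewrite -lecR -nrmE; exact: normr_ge0. Qed.

Lemma nrmD x y : nrm (x + y) <= nrm x + nrm y.
Proof. by rewrite -lecR rmorphD/= -!nrmE ler_normD. Qed.

Lemma nrmN x : nrm (- x) = nrm x.
Proof. by rewrite /nrm normrN. Qed.

Lemma nrmB x y : nrm (x - y) <= nrm x + nrm y.
Proof. by rewrite (le_trans (nrmD _ _))// nrmN. Qed.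

Lemma nrm0 : nrm (0 : V) = 0.
Proof. by rewrite /nrm normr0. Qed.

Lemma nrm_eq0 x : (nrm x == 0) = (x == 0).
Proof. by rewrite -[x == 0]normr_eq0 nrmE -(inj_eq (@complexI R)). Qed.

Lemma nrm_gt0 x : (0 < nrm x) = (x != 0).
Proof. by rewrite lt_def nrm_eq0 nrm_ge0 andbT. Qed.

End NormedModule.

Lemma nrmZ (V : normedModType R[i]) (c : R[i]) (x : V) :
  nrm (c *: x) = nrm (c : R[i]^o) * nrm x.
Proof. by apply: complexI; rewrite rmorphM/= -!nrmE normrZ. Qed.

Lemma nrm_real (c : R) : 0 <= c -> nrm (c%:C : R[i]^o) = c.
Proof. by move=> c0; apply: complexI; rewrite -nrmE ger0_norm ?lecR. Qed.

Lemma nrmM (a b : R[i]) :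
  nrm (a * b : R[i]^o) = nrm (a : R[i]^o) * nrm (b : R[i]^o).
Proof. by apply: complexI; rewrite rmorphM/= -!nrmE normrM. Qed.

End RealNorm.

(** * Approximate eigenvectors on subspaces of finite codimension *)

(** This is [(1 + y)^2 - (1 - y)^2 = 4y] applied to [x], where [a] and [b] stand
    for [y x] and [y (y x)]. *)
Lemma scaled_square_diff (K : pzRingType) (V : lmodType K) (x a b : V) :
  (x + a + (a + b)) - (x - a - (a - b)) = 4 *: a.
Proof.
have -> : x + a + (a + b) = (x + b) + (a + a) by rewrite [a + b]addrC addrACA.
have -> : x - a - (a - b) = (x + b) - (a + a) by rewrite opprB addrACA -opprD.
rewrite opprB addrC -addrA addKr.
by rewrite -!mulr2n -mulrnA scaler_nat.
Qed.

Section EssentiallyApproximateEigenvalue.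
Context (R : realType) (V : normedModType R[i]).

(** Properties that hold on some subspace of finite codimension: they are stable
    under conjunction and under linear preimage, so they behave like
    properties true up to a negligible set. The subspace is given as the kernel
    of a linear map, and not as an orthogonal complement, so that preimages can
    be taken without adjoints. *)
Definition fincodim (P : V -> Prop) :=
  exists n (f : {linear V -> 'rV[R[i]]_n}), forall x, f x = 0 -> P x.

Definition infinite_dim := forall P, fincodim P -> exists2 x : V, x != 0 & P x.

Lemma fincodimS (P Q : V -> Prop) :
  (forall x, P x -> Q x) -> fincodim P -> fincodim Q.
Proof. by move=> PQ [n [f fP]]; exists n, f => x /fP/PQ. Qed.

Lemma fincodimT (P : V -> Prop) : (forall x, P x) -> fincodim P.
Proof. by move=> P_; exists 0%N, (\0 : {linear V -> 'rV[R[i]]_0}). Qed.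

Lemma fincodimI (P Q : V -> Prop) :
  fincodim P -> fincodim Q -> fincodim (fun x => P x /\ Q x).
Proof.
move=> [n [f fP]] [m [g gQ]].
pose h x := row_mx (f x) (g x).
have hlin : linear h.
  by move=> a x y; rewrite /h !linearP scale_row_mx add_row_mx.
pose hL := GRing.isLinear.Build _ _ _ _ h hlin.
pose h' : {linear V -> 'rV[R[i]]_(n + m)} := HB.pack h hL.
exists (n + m)%N, h' => x.
rewrite /= /h -row_mx0 => /eq_row_mx[fx gx].
by split; [exact: fP|exact: gQ].
Qed.

Lemma fincodim_preim (y : {linear V -> V}) (P : V -> Prop) :
  fincodim P -> fincodim (fun x => P (y x)).
Proof. by move=> [n [f fP]]; exists n, (f \o y) => x /= /fP. Qed.

Lemma fincodim_ker (f : {scalar V}) : fincodim (fun x => f x = 0).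
Proof.
pose h x : 'rV[R[i]]_1 := (f x)%:M.
have hlin : linear h.
  by move=> a x y; rewrite /h linearP raddfD/= -scale_scalar_mx.
pose hL := GRing.isLinear.Build _ _ _ _ h hlin.
pose h' : {linear V -> 'rV[R[i]]_1} := HB.pack h hL.
exists 1%N, h' => x /= /matrixP/(_ 0 0).
by rewrite !mxE eqxx mulr1n.
Qed.

(** [iter_square z m] is [z ^ (2 ^ m)]. *)
Fixpoint iter_square (z : {linear V -> V}) m : {linear V -> V} :=
  if m is k.+1 then iter_square z k \o iter_square z k else z.

(** The operator [1 - c y]: a resolvent of [y] in the variable [1 / c], written
    so that [c = 0] is allowed. *)
Definition one_minus (y : {linear V -> V}) (c : R[i]) : {linear V -> V} :=
  idfun \- (c \*: y).

Arguments one_minus : simpl never.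

Lemma one_minusE y c x : one_minus y c x = x - c *: y x. Proof. by []. Qed.

(** If [1 - v] is invertible, with [v = c y], this bounds [v (1 - v)^-2];
    phrased as a domination of vectors it needs no inverse. *)
Definition square_dominated (y : {linear V -> V}) (eta : R) := forall c : R[i],
  fincodim (fun x =>
    nrm (c *: y x) <= eta * nrm (one_minus y c (one_minus y c x))).

Lemma one_minusN y c x : one_minus y (- c) x = x + c *: y x.
Proof. by rewrite one_minusE scaleNr opprK. Qed.

Lemma one_minus_sq y c x :
  one_minus y c (one_minus y (- c) x) = one_minus (y \o y) (c * c) x.
Proof.
rewrite !one_minusE scaleNr opprK [y (_ + _)]linearD [y (_ *: _)]linearZ/=.
by rewrite scalerDr scalerA opprD addrA addrK.
Qed.

Lemma one_minusN_sq y c x :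
  one_minus y (- c) (one_minus y c x) = one_minus (y \o y) (c * c) x.
Proof. by rewrite -{2}[c]opprK one_minus_sq mulrNN. Qed.

(** With [v^2 = c y^2], the identity [4 v^2 = v (1 + v)^2 - v (1 - v)^2] shows
    that [v^2 (1 - v^2)^-2] is the average of [v (1 - v)^-2 / 2] and
    [- v (1 + v)^-2 / 2]: squaring the operator halves the constant. *)
Lemma square_dominated_sq y eta :
  square_dominated y eta -> square_dominated (y \o y) (eta / 2).
Proof.
move=> yeta c; pose d := sqrtC c.
have cE : c = d * d by rewrite -expr2 sqrtCK.
have dN := yeta (- d); have dP := yeta d.
pose mm := one_minus y d; pose pp := one_minus y (- d).
pose rr := one_minus (y \o y) (d * d).
have mp u : mm (pp u) = rr u by exact: one_minus_sq.
have pm u : pp (mm u) = rr u by exact: one_minusN_sq.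
have := fincodimI (fincodim_preim (pp \o pp) dP) (fincodim_preim (mm \o mm) dN).
apply: fincodimS => x; rewrite cE.
change (nrm (d *: y (pp (pp x))) <= eta * nrm (mm (mm (pp (pp x)))) /\
  nrm (- d *: y (mm (mm x))) <= eta * nrm (pp (pp (mm (mm x)))) ->
  nrm ((d * d) *: y (y x)) <= eta / 2 * nrm (rr (rr x))).
have -> : mm (mm (pp (pp x))) = rr (rr x).
  by rewrite (mp (pp x)) -(pm (pp x)) (mp x) mp.
have -> : pp (pp (mm (mm x))) = rr (rr x).
  by rewrite (pm (mm x)) -(mp (mm x)) (pm x) pm.
rewrite scaleNr nrmN => -[H1 H2].
have E4 : 4 *: ((d * d) *: y (y x)) = d *: y (pp (pp x)) - d *: y (mm (mm x)).
  rewrite -scalerBr -linearB.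
  have -> : pp (pp x) - mm (mm x) = 4 *: (d *: y x).
    rewrite /pp /mm !one_minusN !one_minusE.
    rewrite [y (_ + _)]linearD [y (_ - _)]linearB/=.
    rewrite scalerDr scalerBr; set a := d *: y x; set b := d *: _.
    exact: scaled_square_diff.
  by rewrite !linearZ/= !scalerA; congr (_ *: _); ring.
have := nrmB (d *: y (pp (pp x))) (d *: y (mm (mm x))).
rewrite -E4 nrmZ.
have -> : nrm (4 : R[i]^o) = 4.
  by rewrite -(@nrm_real R 4) ?rmorph_nat.
by move=> H3; lra.
Qed.

(** When [u = 2 c y] has norm at most [1/2], [(1 - u)^2] has norm at most [9/4],
    so the domination gives back norm at most [(1/9) (9/4) = 1/4] for [u]. *)
Lemma square_dominated_double y eta c : eta <= 9^-1 -> square_dominated y eta ->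
  fincodim (fun x => nrm (c *: y x) <= 4^-1 * nrm x) ->
  fincodim (fun x => nrm ((2 * c) *: y x) <= 4^-1 * nrm x).
Proof.
move=> eta9 yeta cy.
apply: fincodimS (fincodimI (yeta (2 * c)) (fincodimI cy
  (fincodim_preim (one_minus y (2 * c)) cy))) => x [H1 [H2 H3]].
have n2 u : nrm ((2 * c) *: y u) = 2 * nrm (c *: y u).
  by rewrite -scalerA nrmZ -(@nrm_real R 2) ?rmorph_nat.
have K1 := nrmB x ((2 * c) *: y x).
have K2 := nrmB (one_minus y (2 * c) x) ((2 * c) *: y (one_minus y (2 * c) x)).
rewrite -!one_minusE !n2 in K1 K2 H1 *.
have K3 : eta * nrm (one_minus y (2 * c) (one_minus y (2 * c) x)) <=
    9^-1 * nrm (one_minus y (2 * c) (one_minus y (2 * c) x)).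
  by rewrite ler_wpM2r ?nrm_ge0.
lra.
Qed.

(** For a bounded [z] on a Hilbert space and for all [e] at once, this says that
    [l] is in the left essential spectrum. *)
Definition ess_ap_eigen (z : V -> V) (l : R[i]) (e : R) := forall P,
  fincodim P -> exists2 x, P x & nrm (z x - l *: x) < e * nrm x.

(** A lower bound [e] for [z - l], uniform in [l], bounds both [(1 - c z)^-1]
    and [c z (1 - c z)^-1] uniformly in [c]: for large [l] the boundedness of [z]
    supplies the decay of the resolvent. *)
Lemma square_dominated_base (z : {linear V -> V}) (B e : R) : 0 < e ->
  (forall x, nrm (z x) <= B * nrm x) ->
  (forall l, fincodim (fun x => e * nrm x <= nrm (z x - l *: x))) ->
  exists eta, square_dominated z eta.
Proof.
move=> e0 zB zlow; pose C := 1 + `|B| / e.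
have B0 : 0 <= `|B| / e by rewrite divr_ge0// ltW.
have low c : fincodim (fun x => nrm x <= C * nrm (one_minus z c x)).
  have [->|c0] := eqVneq c 0.
    apply: fincodimT => x; rewrite one_minusE scale0r subr0.
    by rewrite ler_peMl ?nrm_ge0// /C lerDl.
  apply: fincodimS (zlow c^-1) => x zx.
  have sE : one_minus z c x = - (c *: (z x - c^-1 *: x)).
    by rewrite one_minusE scalerBr scalerA divff// scale1r opprB.
  have cz : nrm (c *: z x) <= `|B| / e * nrm (one_minus z c x).
    rewrite sE nrmN !nrmZ mulrCA ler_wpM2l ?nrm_ge0//.
    rewrite (le_trans (zB x))// -mulrA.
    rewrite (le_trans (ler_wpM2r (nrm_ge0 x) (ler_norm B)))//.
    by rewrite ler_wpM2l// ler_pdivlMl.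
  have := nrmD (one_minus z c x) (c *: z x).
  by rewrite {1}one_minusE subrK /C mulrDl mul1r => /le_trans->//; rewrite lerD2l.
exists ((1 + C) * C) => c.
apply: fincodimS (fincodimI (low c) (fincodim_preim (one_minus z c) (low c))).
move=> x [H1 H2].
have := nrmB x (one_minus z c x).
rewrite [in X in X <= _]one_minusE opprB addrC subrK => /le_trans->//.
rewrite -mulrA mulrDl mul1r.
have C0 : 1 <= C by rewrite /C lerDl.
set a := nrm (one_minus z c (one_minus z c x)) in H2 *.
set b := nrm (one_minus z c x) in H1 H2 *.
nra.
Qed.

Lemma iter_square_bounded (z : {linear V -> V}) (B : R) m :
  (forall x, nrm (z x) <= B * nrm x) ->
  exists2 B', 0 < B' & forall x, nrm (iter_square z m x) <= B' * nrm x.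
Proof.
move=> zB; elim: m => [|m [B' B'0 IH]].
  exists (`|B| + 1); first by rewrite ltr_wpDl.
  move=> x; rewrite (le_trans (zB x))// ler_wpM2r ?nrm_ge0//.
  by rewrite ler_wpDr// ler_norm.
exists (B' * B') => [|x]; first exact: mulr_gt0.
rewrite (le_trans (IH _))// -mulrA ler_wpM2l ?IH//; exact: ltW.
Qed.

Lemma iter_square_low (z : {linear V -> V}) (e : R) m : 0 < e ->
  fincodim (fun x => e * nrm x <= nrm (z x)) ->
  exists2 e', 0 < e' &
    fincodim (fun x => e' * nrm x <= nrm (iter_square z m x)).
Proof.
move=> e0 ze; elim: m => [|m [e' e'0 IH]]; first by exists e.
exists (e' * e'); first exact: mulr_gt0.
have := fincodimI IH (fincodim_preim (iter_square z m) IH).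
apply: fincodimS => x [H1 H2].
by rewrite (le_trans _ H2)// -mulrA ler_wpM2l// ltW.
Qed.

Lemma iter_square_dominated (z : {linear V -> V}) eta m :
  square_dominated z eta -> square_dominated (iter_square z m) (eta / 2 ^+ m).
Proof.
move=> zeta; elim: m => [|m IH]; first by rewrite expr0 divr1.
by rewrite exprSr invfM mulrA; exact: square_dominated_sq.
Qed.

(** A form of the nonemptiness of the spectrum that uses lower bounds only:
    neither completeness, nor inverses, nor holomorphic functions. If every
    [z - l] is bounded below by [e], then for [m] large [y = z ^ (2 ^ m)] is
    dominated with constant at most [1/9]. Starting from a small [c], the scalar
    can then be doubled forever while [c y] keeps norm at most [1/4]; so [y] has
    arbitrarily small norm on subspaces of finite codimension, whereas it is
    bounded below on one of them. *)
Theorem ess_ap_eigen_exists (z : {linear V -> V}) (B e : R) :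
  infinite_dim -> 0 < e -> (forall x, nrm (z x) <= B * nrm x) ->
  exists l, ess_ap_eigen z l e.
Proof.
move=> Vinf e0 zB; apply: contrapT => /forallNP noeig.
have zlow l : fincodim (fun x => e * nrm x <= nrm (z x - l *: x)).
  have /existsNP[P /not_implyP[Pfin /forall2NP nP]] := noeig l.
  apply: fincodimS Pfin => x Px.
  by have [//|/negP] := nP x; rewrite -leNgt.
have [eta zeta] := square_dominated_base e0 zB zlow.
have [m etam] : exists m, eta / 2 ^+ m <= 9^-1.
  have ub := upper_nthrootP (leqnn (Num.Def.archi_bound (9 * eta))).
  eexists; rewrite ler_pdivrMr ?exprn_gt0// mulrC ler_pdivlMr// mulrC.
  exact: ltW ub.
have ysmall := iter_square_dominated m zeta.
have [B' B'0 yB] := iter_square_bounded m zB.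
have [e' e'0 ylow] : exists2 e', 0 < e' &
    fincodim (fun x => e' * nrm x <= nrm (iter_square z m x)).
  apply: (iter_square_low _ e0); apply: fincodimS (zlow 0) => x.
  by rewrite scale0r subr0.
set y := iter_square z m in ysmall yB ylow.
(* starting scalar: [B'] bounds [y], so [c y] has norm at most [1/4] *)
pose c : R := (4 * B')^-1.
have c0 : 0 < c by rewrite invr_gt0 mulr_gt0.
have ysm j : fincodim (fun x => nrm ((2 ^+ j * c%:C) *: y x) <= 4^-1 * nrm x).
  elim: j => [|j IH]; last first.
    by rewrite exprS -mulrA; exact: square_dominated_double etam ysmall IH.
  apply: fincodimT => x; rewrite expr0 mul1r nrmZ (nrm_real (ltW c0)).
  rewrite (le_trans (ler_wpM2l (ltW c0) (yB x)))// mulrA /c invfM.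
  by rewrite mulfVK// gt_eqF.
have bnd j : 2 ^+ j * (c * e') <= 4^-1.
  have [x x0 [H1 H2]] := Vinf _ (fincodimI (ysm j) ylow).
  have nx : 0 < nrm x by rewrite nrm_gt0.
  rewrite -(ler_pM2r nx) (le_trans _ H1)// nrmZ nrmM.
  rewrite (nrm_real (ltW c0)).
  have -> : nrm (2 ^+ j : R[i]^o) = 2 ^+ j.
    by rewrite -(@nrm_real R (2 ^+ j)) ?exprn_ge0// rmorphXn rmorph_nat.
  by rewrite -!mulrA !ler_pM2l ?exprn_gt0.
have ub := upper_nthrootP (leqnn (Num.Def.archi_bound (4^-1 / (c * e')))).
move: ub; rewrite ltr_pdivrMr ?mulr_gt0// => /lt_le_trans/(_ (bnd _)).
by rewrite ltxx.
Qed.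

End EssentiallyApproximateEigenvalue.

(** * Limits and perturbations of the identity *)

Section Limits.
Context (R : realType) (H : completeNormedModType R[i]).
Implicit Types (u : nat -> H) (x l : H).

Lemma nrm_ltE (V : normedModType R[i]) (x : V) (e : R) :
  (`|x| < e%:C) = (nrm x < e).
Proof. by rewrite nrmE ltcR. Qed.

Lemma nrm_leE (V : normedModType R[i]) (x : V) (e : R) :
  (`|x| <= e%:C) = (nrm x <= e).
Proof. by rewrite nrmE lecR. Qed.

Lemma pos_complexE (e : R[i]) : 0 < e -> exists2 r : R, 0 < r & e = r%:C.
Proof.
move=> e0; have eE := Re_ge0K (ltW e0); exists (complex.Re e) => //.
by rewrite -ltcR eE.
Qed.

Lemma cvg_nrmP u l : u @ \oo --> l <->
  forall e : R, 0 < e -> exists N, forall n, (N <= n)%N -> nrm (l - u n) < e.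
Proof.
split=> [/cvgrPdist_lt ul e e0|ul].
  have /ul[N _ uN] : 0 < e%:C by rewrite ltcR.
  by exists N => n /uN /=; rewrite nrm_ltE.
apply/cvgrPdist_lt => _ /pos_complexE[e e0 ->].
have [N uN] := ul _ e0; exists N => // n /uN.
by rewrite /= nrm_ltE.
Qed.

Lemma cauchy_nrm_cvg u :
  (forall e : R, 0 < e -> exists N, forall m n, (N <= m)%N -> (m <= n)%N ->
     nrm (u n - u m) < e) ->
  exists l, u @ \oo --> l.
Proof.
move=> uC; suff : cvg (u @ \oo) by move=> ?; exists (lim (u @ \oo)).
apply: cauchy_cvg; apply: cauchy_exP => _ /pos_complexE[e e0 ->].
have [N uN] := uC _ e0; exists (u N); exists N => // n /= Nn.
by rewrite -ball_normE/= distrC nrm_ltE uN.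
Qed.

Lemma cvg_nrm_le u l (M : R) :
  u @ \oo --> l -> (forall n, nrm (u n) <= M) -> nrm l <= M.
Proof.
move=> /cvg_nrmP ul uM; apply/ler_addgt0Pr => e /ul[N /(_ _ (leqnn N)) uN].
have := nrmD (l - u N) (u N); rewrite subrK => /le_trans-> //.
by rewrite addrC lerD// ltW.
Qed.

Lemma cvg_bounded (T : {linear H -> H}) (B : R) u l :
  (forall x, nrm (T x) <= B * nrm x) -> u @ \oo --> l ->
  (fun n => T (u n)) @ \oo --> T l.
Proof.
move=> TB /cvg_nrmP ul; apply/cvg_nrmP => e e0.
have B0 : 0 < `|B| + 1 by rewrite ltr_wpDl.
have /ul[N uN] : 0 < e / (`|B| + 1) by rewrite divr_gt0.
exists N => n /uN; rewrite ltr_pdivlMr// => uNe.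
rewrite -linearB (le_lt_trans _ uNe)// (le_trans (TB _))// mulrC.
by rewrite ler_wpM2l ?nrm_ge0// ler_wpDr// ler_norm.
Qed.

(** The solution is the limit of the iteration [y := b - D y], whose increments
    decrease geometrically. *)
Lemma contraction_onto (D : {linear H -> H}) (q : R) : 0 <= q -> q < 1 ->
  (forall x, nrm (D x) <= q * nrm x) -> forall b, exists y, y + D y = b.
Proof.
move=> q0 q1 Dq b.
pose u := fix u n := if n is k.+1 then b - D (u k) else 0.
have uS n : nrm (u n.+1 - u n) <= q ^+ n * nrm b.
  elim: n => [|n IH]; first by rewrite /= linear0 !subr0 expr0 mul1r.
  have -> : u n.+2 - u n.+1 = - D (u n.+1 - u n).
    rewrite (linearB D (u n.+1) (u n)).
    change (b - D (u n.+1) - (b - D (u n)) = - (D (u n.+1) - D (u n))).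
    by rewrite !opprB addrC addrA subrK.
  by rewrite nrmN (le_trans (Dq _))// exprS -mulrA ler_wpM2l.
have uD m k :
    (1 - q) * nrm (u (m + k)%N - u m) <= (1 - q ^+ k) * (q ^+ m * nrm b).
  elim: k => [|k IH]; first by rewrite addn0 !subrr nrm0 mulr0 mul0r.
  rewrite addnS.
  have := nrmD (u (m + k).+1 - u (m + k)%N) (u (m + k)%N - u m).
  rewrite addrA subrK => H1.
  have H2 := uS (m + k)%N.
  have : (1 - q) * nrm (u (m + k).+1 - u m) <=
      (1 - q) * (q ^+ (m + k) * nrm b + nrm (u (m + k)%N - u m)).
    rewrite ler_wpM2l ?subr_ge0 ?(ltW q1)// (le_trans H1)//.
    by rewrite lerD2r.
  move=> /le_trans->//; rewrite mulrDr.
  rewrite (le_trans (lerD (lexx _) IH))// exprD exprS.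
  lra.
have [l ul] : exists l, u @ \oo --> l.
  apply: cauchy_nrm_cvg => e e0.
  have : (fun n => q ^+ n) @ \oo --> (0 : R).
    by apply: cvg_expr; rewrite ger0_norm.
  have d0 : 0 < e * (1 - q) / (nrm b + 1).
    by rewrite divr_gt0 ?mulr_gt0 ?subr_gt0// ltr_wpDl ?nrm_ge0.
  move=> /cvgrPdist_lt/(_ _ d0)[N _ qN]; exists N => m n Nm mn.
  have := qN m Nm; rewrite /= sub0r normrN ger0_norm ?exprn_ge0//.
  rewrite ltr_pdivlMr ?ltr_wpDl ?nrm_ge0// => qm.
  have := uD m (n - m)%N; rewrite subnKC// => H1.
  rewrite -(@ltr_pM2l _ (1 - q)) ?subr_gt0// (le_lt_trans H1)//.
  rewrite [(1 - q) * e]mulrC (le_lt_trans _ qm)//.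
  have qk : 0 <= q ^+ (n - m) by rewrite exprn_ge0.
  have qm0 : 0 <= q ^+ m by rewrite exprn_ge0.
  have b0 := nrm_ge0 b.
  have : 0 <= q ^+ m * nrm b by rewrite mulr_ge0.
  rewrite mulrDr mulr1; nra.
exists l.
have ulS : (fun n => u n.+1) @ \oo --> l by rewrite cvg_shiftS.
have : (fun n => b - D (u n)) @ \oo --> b - D l.
  apply: cvgB; first exact: cvg_cst.
  exact: cvg_bounded Dq ul.
move=> ub; have lE : l = b - D l by exact: (cvg_unique _ ulS ub).
by rewrite {1}lE subrK.
Qed.

End Limits.

(** * Operators between orthogonal systems *)

Section InnerProduct.
Context (R : realType) (H : completeNormedModType R[i])
  (dot : {dot H for Num.conj})
  (dot_norm : forall x : H, `|x| = sqrtC (dot x x)).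
Implicit Types (x y : H) (a b : nat -> H).

Lemma dot_self x : dot x x = ((nrm x) ^+ 2)%:C.
Proof. by rewrite rmorphXn/= -nrmE dot_norm sqrtCK. Qed.

Lemma dotC x y : dot y x = (dot x y)^*.
Proof. by rewrite (hermC dot) expr0 mul1r. Qed.

Lemma dot0C x y : dot x y = 0 -> dot y x = 0.
Proof. by move=> xy; rewrite dotC xy rmorph0. Qed.

Lemma nrm2D x y : dot x y = 0 -> nrm (x + y) ^+ 2 = nrm x ^+ 2 + nrm y ^+ 2.
Proof.
move=> xy; apply: complexI; rewrite rmorphD/= -!dot_self.
by rewrite linearDl/= !linearDr/= xy (dot0C xy) add0r addr0.
Qed.

Lemma nrm_dot_sq (z : R[i]) : z * z^* = ((nrm (z : R[i]^o)) ^+ 2)%:C.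
Proof. by rewrite rmorphXn/= -nrmE normCK. Qed.

Lemma nrm2B x y (s : R) : dot x y = s%:C ->
  nrm (x - y) ^+ 2 = nrm x ^+ 2 + nrm y ^+ 2 - 2 * s.
Proof.
move=> xy; have yx : dot y x = s%:C by rewrite dotC xy conjc_real.
apply: complexI; rewrite rmorphB rmorphD/= -!dot_self rmorphM rmorph_nat.
rewrite linearBl/= !linearBr/= xy yx.
by ring.
Qed.

Definition orthogonal_seq a := forall i j, i != j -> dot (a i) (a j) = 0.

(** Vectors of norm less than [1], in particular zero vectors, are allowed: the
    Bessel inequality survives, and Gram-Schmidt may output zeros. *)
Definition contracting_ortho a := orthogonal_seq a /\ forall i, nrm (a i) <= 1.

Lemma nrm2_sum b (c : nat -> R[i]) m n : orthogonal_seq b ->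
  nrm (\sum_(m <= i < n) c i *: b i) ^+ 2 =
  \sum_(m <= i < n) nrm (c i : R[i]^o) ^+ 2 * nrm (b i) ^+ 2.
Proof.
move=> bo; elim: n => [|n IH]; first by rewrite !big_geq// nrm0 expr0n.
have [nm|mn] := ltnP n m; first by rewrite !big_geq// nrm0 expr0n.
rewrite !big_nat_recr//= nrm2D ?IH ?nrmZ ?exprMn//.
rewrite linear_sumlz big_nat big1// => i /andP[_ ni].
by rewrite linearZl_LR linearZr_LR/= bo ?mulr0// ltn_eqF.
Qed.

Lemma dot_sumZr x b (c : nat -> R[i]) m n :
  dot x (\sum_(m <= i < n) c i *: b i) =
  \sum_(m <= i < n) (c i)^* * dot x (b i).
Proof. by rewrite linear_sumr; apply: eq_bigr => i _; rewrite linearZr_LR. Qed.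

Lemma dot_sumZl x b (c : nat -> R[i]) m n :
  dot (\sum_(m <= i < n) c i *: b i) x = \sum_(m <= i < n) c i * dot (b i) x.
Proof. by rewrite linear_sumlz; apply: eq_bigr => i _; rewrite linearZl_LR. Qed.

Definition transport_sum a b x n : H := \sum_(0 <= i < n) dot x (a i) *: b i.

(** With [s] the sum and [S] the partial expansion of [x], [dot x S = s] and
    [|S|^2 <= s], so that [|x - S|^2 = |x|^2 - 2 s + |S|^2 <= |x|^2 - s]. *)
Lemma bessel_gap a x n : contracting_ortho a ->
  nrm (x - transport_sum a a x n) ^+ 2 +
    \sum_(0 <= i < n) nrm (dot x (a i) : R[i]^o) ^+ 2 <= nrm x ^+ 2.
Proof.
move=> [ao a1]; set s := \sum_(_ <= _ < _) _.
pose y := transport_sum a a x n.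
have xy : dot x y = s%:C.
  rewrite dot_sumZr rmorph_sum/=; apply: eq_bigr => i _.
  by rewrite mulrC nrm_dot_sq.
have ys : nrm y ^+ 2 <= s.
  rewrite nrm2_sum//; apply: ler_sum => i _.
  by rewrite ler_piMr ?sqr_ge0// expr_le1// nrm_ge0.
rewrite (nrm2B xy); lra.
Qed.

Lemma bessel a x n : contracting_ortho a ->
  \sum_(0 <= i < n) nrm (dot x (a i) : R[i]^o) ^+ 2 <= nrm x ^+ 2.
Proof.
by move=> /(bessel_gap x n); apply: le_trans; rewrite lerDr sqr_ge0.
Qed.

Lemma transport_sum_residual a x n : contracting_ortho a ->
  nrm (x - transport_sum a a x n) <= nrm x.
Proof.
move=> /(bessel_gap x n) h; rewrite -(@ler_pXn2r _ 2) ?nnegrE ?nrm_ge0//.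
by apply: le_trans h; rewrite lerDl; apply: sumr_ge0 => i _; rewrite sqr_ge0.
Qed.

Lemma transport_sum_le a b x n : contracting_ortho a -> contracting_ortho b ->
  nrm (transport_sum a b x n) <= nrm x.
Proof.
move=> aP [bo b1]; rewrite -(@ler_pXn2r _ 2) ?nnegrE ?nrm_ge0//.
rewrite (le_trans _ (bessel x n aP))// nrm2_sum//; apply: ler_sum => i _.
by rewrite ler_piMr ?sqr_ge0// expr_le1// nrm_ge0.
Qed.

Lemma transport_sum_linear a b n : linear (fun x => transport_sum a b x n).
Proof.
move=> c x y; rewrite /transport_sum scaler_sumr -big_split/=.
by apply: eq_bigr => i _; rewrite linearPl/= scalerDl scalerA.
Qed.

Lemma transport_sum_cvg a b x : contracting_ortho a -> contracting_ortho b ->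
  exists l : H, transport_sum a b x @ \oo --> l.
Proof.
move=> aP [bo b1].
pose s n := \sum_(0 <= i < n) nrm (dot x (a i) : R[i]^o) ^+ 2.
have sup_s : has_sup (range s).
  by split; [exists (s 0%N), 0%N|exists (nrm x ^+ 2) => _ [n _ <-]; exact: bessel].
apply: cauchy_nrm_cvg => e e0.
have [_ [N _ <-] sN] := sup_adherent (exprn_gt0 2 e0) sup_s.
exists N => m n Nm mn.
have s_mono k l : (k <= l)%N -> s k <= s l.
  move=> kl; rewrite /s (big_cat_nat (leq0n k) kl)/= lerDl.
  by apply: sumr_ge0 => i _; rewrite sqr_ge0.
have sn : s n <= sup (range s) by apply: sup_upper_bound => //; exists n.
have : nrm (transport_sum a b x n - transport_sum a b x m) ^+ 2 <= s n - s m.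
  rewrite /transport_sum /s (big_cat_nat (leq0n m) mn)/= [X in X - _]addrC addrK.
  rewrite [X in _ <= X - _](big_cat_nat (leq0n m) mn)/=.
  rewrite [X in _ <= X - _]addrC addrK nrm2_sum//; apply: ler_sum => i _.
  by rewrite ler_piMr ?sqr_ge0// expr_le1// nrm_ge0.
have := s_mono _ _ Nm => H1 H2.
rewrite -(@ltr_pXn2r _ 2) ?nnegrE ?nrm_ge0 ?ltW//.
apply: le_lt_trans H2 _; lra.
Qed.

(** The operator that carries the system [a] to the system [b]: it serves both
    as an isometry into a subspace and as the adjoint of one. *)
Lemma transport_exists a b : contracting_ortho a -> contracting_ortho b ->
  exists J : bounded_op H, (forall x, nrm (J x) <= nrm x) /\
    forall x, transport_sum a b x @ \oo --> J x.
Proof.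
move=> aP bP; have [J JP] := choice (fun x => transport_sum_cvg x aP bP).
have J1 x : nrm (J x) <= nrm x.
  by apply: cvg_nrm_le (JP x) _ => n; exact: transport_sum_le.
have Jlin : linear J.
  move=> c x y; apply: (cvg_unique _ (JP _)) => //.
  rewrite (_ : transport_sum a b _ = fun n =>
      c *: transport_sum a b x n + transport_sum a b y n); last first.
    by apply/funext => n; exact: transport_sum_linear.
  by apply: cvgD; [apply: cvgZr|]; exact: JP.
have Jb : J \in @bounded_op_pred R H.
  by apply/bounded_opP; split => //; exists 1 => x; rewrite mul1r !nrmE lecR.
by exists (BoundedOp Jb).
Qed.

Lemma cauchy_schwarz x y :
  nrm (dot x y : R[i]^o) <= nrm x * nrm y.
Proof.
have [->|y0] := eqVneq y 0; first by rewrite linear0r nrm0 nrm0 mulr0.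
have ny : 0 < nrm y by rewrite nrm_gt0.
have ny' : 0 <= (nrm y)^-1 by rewrite invr_ge0 ltW.
pose a n := if n is 0%N then (nrm y)^-1%:C *: y else 0.
have aP : contracting_ortho a.
  split=> [[|i] [|j]//|[|i]] /=; rewrite ?linear0l ?linear0r ?nrm0//.
  by rewrite nrmZ nrm_real// mulVf// gt_eqF.
have := bessel x 1 aP; rewrite big_nat1 ler_pXn2r ?nnegrE ?nrm_ge0//.
have cE (c : R) : Num.conj (c%:C : R[i]) = c%:C by exact: conjc_real.
by rewrite linearZr_LR/= cE nrmM nrm_real// ler_pdivrMl// mulrC.
Qed.

Lemma cvg_dot (u : nat -> H) l y : u @ \oo --> l ->
  (forall e : R, 0 < e -> exists N, forall n, (N <= n)%N ->
    nrm (dot l y - dot (u n) y : R[i]^o) < e).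
Proof.
move=> /cvg_nrmP ul e e0.
have /ul[N uN] : 0 < e / (nrm y + 1) by rewrite divr_gt0// ltr_wpDl ?nrm_ge0.
exists N => n /uN; rewrite ltr_pdivlMr ?ltr_wpDl ?nrm_ge0// => uNe.
rewrite -linearBl (le_lt_trans (cauchy_schwarz _ _))// (le_lt_trans _ uNe)//.
by rewrite ler_wpM2l ?nrm_ge0// lerDl.
Qed.

Lemma dot_cvg_eventually (u : nat -> H) l y (z : R[i]) N :
  u @ \oo --> l -> (forall n, (N <= n)%N -> dot (u n) y = z) -> dot l y = z.
Proof.
move=> ul uz; apply/eqP; rewrite -subr_eq0 -[_ == 0](nrm_eq0 (_ : R[i]^o)).
rewrite eq_le nrm_ge0 andbT; apply/ler_addgt0Pr => e e0; rewrite add0r.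
have [M uM] := cvg_dot y ul e0.
have := uM _ (leq_maxr N M); rewrite uz ?leq_maxl//; exact: ltW.
Qed.

End InnerProduct.

(** * Orthogonal sequences *)

(** Dependent choice where each term is selected from the list of all the
    previous ones. *)
Lemma greedy_sequence (T : Type) (Q : seq T -> T -> Prop) :
  (forall s, exists x, Q s x) -> exists u, forall n, Q (mkseq u n) (u n).
Proof.
move=> /choice[g gP]; pose pre n := iter n (fun s => rcons s (g s)) [::].
exists (fun n => g (pre n)) => n.
suff -> : mkseq (fun n => g (pre n)) n = pre n by exact: gP.
by elim: n => // n IH; rewrite mkseqS IH.
Qed.

Section Sequences.
Context (R : realType) (H : completeNormedModType R[i])
  (dot : {dot H for Num.conj})
  (dot_norm : forall x : H, `|x| = sqrtC (dot x x)).
Implicit Types (x y : H) (a b : nat -> H).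

Lemma fincodim_orthogonal (s : seq H) :
  fincodim (fun x => forall w, w \in s -> dot x w = 0).
Proof.
elim: s => [|w s IH]; first exact: fincodimT.
have wx : fincodim (fun x => dot x w = 0).
  exact: (fincodim_ker (applyr dot w : {scalar H})).
apply: fincodimS (fincodimI wx IH) => x [xw xs] v.
by rewrite inE => /predU1P[->//|/xs].
Qed.

(** The conditions to be orthogonal to the previous [u] and to have an image
    orthogonal to their images cut out a subspace of finite codimension, where
    [A] still has an almost null vector. Since the images are orthogonal too,
    [A] has norm at most [e] on the whole closed span of [u]; with a fixed [e], mere
    smallness on each [u n] would not give this. *)
Lemma singular_sequence (A : {linear H -> H}) (e : R) :
  (forall P, fincodim P -> exists2 x, P x & nrm (A x) < e * nrm x) ->
  exists u : nat -> H, [/\ forall n, nrm (u n) = 1, orthogonal_seq dot u,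
    orthogonal_seq dot (A \o u) & forall n, nrm (A (u n)) <= e].
Proof.
move=> Ae.
pose Q (s : seq H) x := [/\ nrm x = 1, nrm (A x) <= e &
  forall w, w \in s -> dot x w = 0 /\ dot (A x) (A w) = 0].
have [|u uQ] := @greedy_sequence _ Q.
  move=> s; have Ps := fincodim_orthogonal s.
  have PAs := fincodim_preim A (fincodim_orthogonal (map A s)).
  have [x [xs Axs] xe] := Ae _ (fincodimI Ps PAs).
  have x0 : 0 < nrm x.
    rewrite nrm_gt0; apply: contraTneq xe => ->.
    by rewrite linear0 nrm0 mulr0 ltxx.
  have inv0 : 0 <= (nrm x)^-1 by rewrite invr_ge0 ltW.
  exists ((nrm x)^-1%:C *: x); split.
  - by rewrite nrmZ nrm_real// mulVf// gt_eqF.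
  - by rewrite linearZ nrmZ nrm_real// mulrC ler_pdivrMr// ltW.
  - move=> w ws; rewrite [A _]linearZ !linearZl_LR/= xs// Axs ?map_f//.
    by rewrite !mulr0.
have ltu m n : (m < n)%N -> dot (u n) (u m) = 0 /\ dot (A (u n)) (A (u m)) = 0.
  move=> mn; have [_ _] := uQ n; apply.
  by apply/mapP; exists m => //; rewrite mem_iota.
exists u; split=> [n|i j|i j|n].
- by have [] := uQ n.
- rewrite neq_ltn => /orP[/ltu[h _]|/ltu[]//]; exact: (dot0C h).
- rewrite neq_ltn => /orP[/ltu[_ h]|/ltu[]//]; exact: (dot0C h).
- by have [] := uQ n.
Qed.

Lemma dense_sequence : separable H ->
  exists d : nat -> H, forall y (e : R), 0 < e -> exists n, nrm (y - d n) < e.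
Proof.
move=> [D /countable_injP[f finj] Dd].
pose d n := xget 0 [set x | D x /\ f x = n].
exists d => y e e0.
have [] := Dd (ball y e%:C)°.
- by exists y; apply: nbhsx_ballx; rewrite ltcR.
- exact: open_interior.
move=> x [/interior_subset yx Dx]; exists (f x).
have -> : d (f x) = x.
  rewrite /d; case: xgetP => [w _ [Dw fw]|/(_ x)[]//].
  by apply: finj => //; rewrite inE.
by move: yx; rewrite -ball_normE/= nrm_ltE.
Qed.

(** Vectors [d n] that depend on the previous ones produce [f n = 0] instead of
    being skipped. *)
Lemma gram_schmidt (d : nat -> H) :
  exists f : nat -> H, [/\ contracting_ortho dot f &
    forall n, transport_sum dot f f (d n) n.+1 = d n].
Proof.
pose res (s : seq H) := d (size s) - \sum_(w <- s) dot (d (size s)) w *: w.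
have [|f fE] :=
    @greedy_sequence _ (fun s x => x = (nrm (res s))^-1%:C *: res s).
  by move=> s; eexists.
pose r n := d n - transport_sum dot f f (d n) n.
have {}fE n : f n = (nrm (r n))^-1%:C *: r n.
  by rewrite fE /res size_mkseq big_map /r /transport_sum /index_iota subn0.
have rf n : r n = (nrm (r n))%:C *: f n.
  rewrite fE scalerA -rmorphM/=; have [->|r0] := eqVneq (r n) 0.
    by rewrite scaler0.
  by rewrite divff ?scale1r ?nrm_eq0.
have f01 n : dot (f n) (f n) = 1 \/ f n = 0.
  rewrite fE; have [->|r0] := eqVneq (r n) 0; [right|left].
    by rewrite scaler0.
  rewrite dot_self// nrmZ nrm_real ?invr_ge0 ?nrm_ge0//.
  by rewrite mulVf ?nrm_eq0// expr1n.
have f1 n : nrm (f n) <= 1.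
  have [|->] := f01 n; last by rewrite nrm0.
  rewrite dot_self// => /complexI h.
  by rewrite -(@expr_le1 _ 2) ?nrm_ge0// h.
have fo_lt n : forall m, (m < n)%N -> dot (f n) (f m) = 0.
  elim/ltn_ind: n => n IH m mn.
  have IH' i : (i < n)%N -> i != m -> dot (f i) (f m) = 0.
    move=> lin; rewrite neq_ltn => /orP[im|mi]; last exact: IH.
    exact/dot0C/IH.
  rewrite fE linearZl_LR/= /r linearBl/= dot_sumZl.
  rewrite (bigD1_seq m) ?mem_index_iota ?iota_uniq//= big_nat_cond big1; last first.
    by move=> i /andP[/andP[_ lin] im]; rewrite IH' ?mulr0.
  by have [->|->] := f01 m; rewrite ?linear0r ?addr0 ?mulr1 ?mulr0 subrr mulr0.
have fo : orthogonal_seq dot f.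
  move=> i j; rewrite neq_ltn => /orP[ij|ji]; last exact: fo_lt.
  exact/dot0C/fo_lt.
exists f; split=> // n.
rewrite /transport_sum big_nat_recr//= -/(transport_sum dot f f (d n) n).
have -> : dot (d n) (f n) = (nrm (r n))%:C * dot (f n) (f n).
  rewrite -[in LHS](subrK (transport_sum dot f f (d n) n) (d n)) -/(r n).
  rewrite linearDl/= dot_sumZl big_nat big1 ?addr0; last first.
    by move=> i /andP[_ lin]; rewrite fo ?mulr0// ltn_eqF.
  by rewrite {1}rf linearZl_LR.
have -> : ((nrm (r n))%:C * dot (f n) (f n)) *: f n = r n.
  have [->|f0] := f01 n; first by rewrite mulr1 -rf.
  by rewrite rf f0 !scaler0.
by rewrite /r addrC subrK.
Qed.

(** For [n < N], the expansion of [y] to order [N] errs by that of [y - d n],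
    since it reproduces [d n]; so the error is at most [nrm (y - d n)]. *)
Lemma complete_orthogonal_system : separable H ->
  exists f : nat -> H, contracting_ortho dot f /\
    forall y, transport_sum dot f f y @ \oo --> y.
Proof.
move=> /dense_sequence[d dd]; have [f [fP fd]] := gram_schmidt d.
exists f; split => // y; apply/cvg_nrmP => e /(dd y)[n yn].
exists n.+1 => N nN.
have dN : transport_sum dot f f (d n) N = d n.
  rewrite /transport_sum (big_cat_nat (leq0n _) nN)/=.
  rewrite -/(transport_sum dot f f (d n) n.+1) fd.
  rewrite big_nat big1 ?addr0// => i /andP[ni _].
  rewrite -[in dot _ _]fd dot_sumZl big_nat big1 ?scale0r// => j /andP[_ jn].
  by rewrite fP.1 ?mulr0// ltn_eqF// (leq_trans jn).
apply: le_lt_trans yn.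
have := transport_sum_residual dot_norm (y - d n) N fP.
have := transport_sum_linear dot f f N (-1) (d n) y.
rewrite /= !scaleN1r dN [- d n + y]addrC => ->.
by rewrite opprD opprK addrA subrK.
Qed.

End Sequences.

(** * A persistent eigenvalue in infinite dimension *)

Section Eigen.
Context (R : realType) (H : completeNormedModType R[i]).

(** [A S] is [e] times a small perturbation of the identity, hence onto. So
    [A u = A (S y)] for some [y], and [S y - u] is in the kernel. *)
Lemma kernel_of_almost_right_inverse (A S : {linear H -> H}) (e q : R) (u : H) :
  0 <= q -> q < e -> (forall y, nrm (A (S y) - e%:C *: y) <= q * nrm y) ->
  (forall y, S y != u) -> exists2 x, x != 0 & A x = 0.
Proof.
move=> q0 qe ASe Su; have e0 : 0 < e by apply: le_lt_trans qe.
have ei0 : 0 <= e^-1 by rewrite invr_ge0 ltW.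
pose D : {linear H -> H} := (e^-1%:C \*: (A \o S)) \- idfun.
have DE y : D y = e^-1%:C *: (A (S y) - e%:C *: y).
  by rewrite scalerBr scalerA -rmorphM/= mulVf ?gt_eqF// scale1r.
have q1 : q / e < 1 by rewrite ltr_pdivrMr// mul1r.
have [|y yD] := @contraction_onto R H D (q / e) (divr_ge0 q0 (ltW e0)) q1 _
    (e^-1%:C *: A u).
  move=> y; rewrite DE nrmZ nrm_real// [q / e]mulrC -mulrA.
  by rewrite ler_wpM2l.
exists (S y - u); first by rewrite subr_eq0.
rewrite linearB; apply/eqP; rewrite subr_eq0; apply/eqP.
have ei : e^-1%:C != 0 :> R[i].
  by rewrite (inj_eq (@complexI R) _ 0) invr_eq0 gt_eqF.
apply: (scalerI ei); rewrite -yD DE scalerBr scalerA -rmorphM/= mulVf ?gt_eqF//.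
by rewrite scale1r addrC subrK.
Qed.

Lemma nrm_op (S : bounded_op H) x : nrm (S x) <= nrm S * nrm x.
Proof.
by have := op_norm_bound S x; rewrite -op_normE !nrmE -rmorphM/= lecR.
Qed.

Lemma nrm_op_le (S : bounded_op H) (M : R) : 0 <= M ->
  (forall x, nrm (S x) <= M * nrm x) -> nrm S <= M.
Proof.
move=> M0 SM; rewrite -nrm_leE op_normE; apply: op_norm_le => x.
rewrite !nrm_leE => x1.
by rewrite (le_trans (SM x))// ler_piMr.
Qed.

Context (dot : {dot H for Num.conj})
  (dot_norm : forall x : H, `|x| = sqrtC (dot x x)).

(** Take [A = T - l] of norm at most [e] on the closed span of an orthonormal
    sequence [u], and a complete orthogonal system [f]. Let [S] carry [f] to the
    shifted sequence [u 1, u 2, ...] and let [W] carry it back, so [W S = 1]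
    while [u 0] is not in the range of [S]. Adding [D = (e - A S) W] to [T]
    gives [(T + D - l) S = e], a right inverse up to a scalar, which almost
    remains one for every [B] near [T + D]. *)
Lemma persistent_eigenvalue (T : bounded_op H) (r : R) :
  infinite_dim H -> separable H -> 0 < r ->
  exists (T' : bounded_op H) (l : R[i]) (e : R), [/\ 0 < e, nrm (T' - T) < r &
    forall B : bounded_op H, nrm (B - T') < e ->
      exists2 x, x != 0 & B x = l *: x].
Proof.
move=> Hinf Hsep r0; pose e := r / 3.
have e0 : 0 < e by rewrite divr_gt0.
have [l Tl] := ess_ap_eigen_exists Hinf e0 (nrm_op T).
pose A : bounded_op H := T - l *: id_op H.
have AE x : A x = T x - l *: x by [].
have Ae P : fincodim P -> exists2 x, P x & nrm (A x) < e * nrm x by exact: Tl.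
clearbody A.
have [u [u1 uo Auo Aue]] := @singular_sequence R H dot A e Ae.
have [f [fP fcvg]] := complete_orthogonal_system dot_norm Hsep.
(* [u 0] is kept out of the range of [S], so that the kernel is not zero *)
pose v n := u n.+1.
have vP : contracting_ortho dot v.
  by split=> [i j ij|i]; [exact: uo|rewrite u1].
have [S [S1 Scvg]] := transport_exists dot_norm fP vP.
have [W [W1 Wcvg]] := transport_exists dot_norm vP fP.
have dotuu n : dot (u n) (u n) = 1 by rewrite dot_self// u1 expr1n.
have dotSv y i : dot (S y) (v i) = dot y (f i).
  apply: (dot_cvg_eventually (N := i.+1) dot_norm (Scvg y)) => n lin.
  rewrite dot_sumZl (bigD1_seq i) ?mem_index_iota ?iota_uniq//= big1 ?addr0.
    by rewrite /v dotuu mulr1.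
  by move=> j ji; rewrite /v uo ?mulr0// eqSS.
have WS y : W (S y) = y.
  apply: (cvg_unique _ (Wcvg (S y))) => //; suff -> :
    transport_sum dot v f (S y) = transport_sum dot f f y by exact: fcvg.
  by apply/funext => n; apply: eq_bigr => i _; rewrite dotSv.
have dotSu y : dot (S y) (u 0%N) = 0.
  apply: (dot_cvg_eventually (N := 0%N) dot_norm (Scvg y)) => n _.
  by rewrite dot_sumZl big1// => i _; rewrite /v uo ?mulr0.
have Su y : S y != u 0%N.
  by apply: contra_eq_neq (dotSu y) => ->; rewrite dotuu oner_eq0.
have AS y : nrm (A (S y)) <= e * nrm y.
  have gP : contracting_ortho dot (fun n => e^-1%:C *: A (v n)).
    split=> [i j ij|i].
      by rewrite linearZl_LR linearZr_LR/= [dot _ _]Auo ?mulr0.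
    rewrite nrmZ nrm_real ?invr_ge0 ?(ltW e0)//.
    by rewrite ler_pdivrMl// mulr1; exact: Aue.
  have := cvg_bounded (nrm_op A) (Scvg y).
  move=> /cvg_nrm_le; apply => n.
  suff : nrm (A (transport_sum dot f v y n)) <= e * nrm y by [].
  have -> : A (transport_sum dot f v y n) =
      e%:C *: transport_sum dot f (fun n => e^-1%:C *: A (v n)) y n.
    rewrite linear_sum scaler_sumr; apply: eq_bigr => i _.
    rewrite linearZ/= !scalerA mulrAC -rmorphM/= divff ?gt_eqF//.
    by rewrite mul1r.
  rewrite nrmZ nrm_real ?(ltW e0)// ler_wpM2l ?(ltW e0)//.
  exact: transport_sum_le.
pose Df x := e%:C *: W x - A (S (W x)).
have Df2 x : nrm (Df x) <= (2 * e) * nrm x.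
  have h1 : nrm (e%:C *: W x) <= e * nrm x.
    by rewrite nrmZ nrm_real ?(ltW e0)// ler_wpM2l ?(ltW e0).
  have h2 : nrm (A (S (W x))) <= e * nrm x.
    by rewrite (le_trans (AS _))// ler_wpM2l ?(ltW e0).
  have := nrmB (e%:C *: W x) (A (S (W x))); rewrite -/(Df x); lra.
have Dlin : linear Df.
  move=> c x y; 
  have -> : Df (c *: x + y) = e%:C *: (c *: W x + W y) -
      (c *: A (S (W x)) + A (S (W y))).
    by congr (_ *: _ - _); rewrite !linearP.
  rewrite /Df scalerBr scalerDr !scalerA [e%:C * c]mulrC.
  by rewrite opprD addrACA.
have Db : Df \in @bounded_op_pred R H.
  apply/bounded_opP; split => //; exists (2 * e)%:C => x.
  by rewrite !nrmE -rmorphM lecR.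
pose D := BoundedOp Db.
exists (T + D), l, e; split => //.
  rewrite addrC addKr (@le_lt_trans _ _ (2 * e))//; last by rewrite /e; lra.
  by apply: nrm_op_le => //; rewrite mulr_ge0// ltW.
move=> B BT.
have [|x x0 Bx] := @kernel_of_almost_right_inverse
    (B - l *: id_op H : bounded_op H) S e (nrm (B - (T + D))) (u 0%N)
    (nrm_ge0 _) BT _ Su.
- move=> y.
  have -> : (B - l *: id_op H) (S y) - e%:C *: y = (B - (T + D)) (S y).
    change (B (S y) - l *: S y - e%:C *: y = B (S y) - (T (S y) + Df (S y))).
    have -> : T (S y) + Df (S y) = l *: S y + e%:C *: y.
      by rewrite /Df WS AE opprB addrCA [T _ + _]addrC subrK addrC.
    by rewrite opprD addrA.
  by rewrite (le_trans (nrm_op _ _))// ler_wpM2l ?nrm_ge0.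
- exists x => //; apply/eqP; rewrite -subr_eq0; apply/eqP; exact: Bx.
Qed.

End Eigen.

(** * Eigenvalues in finite dimension *)

Section FiniteDimension.
Context (C : closedFieldType) (V : lmodType C) (T : {linear V -> V}).

Implicit Types (p : {poly C}) (x : V).

Definition poly_act p x := \sum_(i < size p) p`_i *: iter i T x.

Lemma poly_actE n p x : (size p <= n)%N ->
  poly_act p x = \sum_(i < n) p`_i *: iter i T x.
Proof.
move=> pn; rewrite /poly_act (big_ord_widen n (fun i => p`_i *: iter i T x))//.
rewrite big_mkcond/=; apply: eq_bigr => i _.
by case: ltnP => // /leq_sizeP/(_ _ (leqnn _))->; rewrite scale0r.
Qed.

Lemma poly_actM p c x :
  poly_act (p * ('X - c%:P)) x = poly_act p (T x - c *: x).
Proof.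
have sz : (size (p * ('X - c%:P))%R <= (size p).+1)%N.
  by rewrite (leq_trans (size_polyMleq _ _))// size_XsubC addn2.
rewrite (poly_actE x sz).
under eq_bigr do rewrite mulrBr coefB coefMX coefMC scalerBl.
rewrite sumrB big_ord_recl/= scale0r add0r [X in _ - X]big_ord_recr/=.
rewrite [p`_(size p)]nth_default// mul0r scale0r addr0 -sumrB.
apply: eq_bigr => i _.
have itB : iter i T (T x - c *: x) = iter i T (T x) - c *: iter i T x.
  elim: (i : nat) => //= k ->; by rewrite linearB linearZ.
by rewrite itB scalerBr scalerA add0n -iterS iterSr.
Qed.

(** Splitting off a root [l] of [p], either [x] is an eigenvector for [l], or
    [T x - l x] is a nonzero vector killed by a polynomial of smaller degree. *)
Lemma eigenvector_of_poly_act p x : p != 0 -> x != 0 -> poly_act p x = 0 ->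
  exists l, exists2 y, y != 0 & T y = l *: y.
Proof.
move sp : (size p) => n; elim: n p x sp => [|n IH] p x sp p0.
  by move: p0; rewrite -size_poly_eq0 sp.
move=> x0 px.
have [/size1_polyC pE|s1] := leqP (size p) 1.
  move: px p0; rewrite /poly_act; rewrite pE size_polyC polyC_eq0.
  move=> + c0; rewrite c0 big_ord1 coefC/= => /eqP.
  by rewrite scaler_eq0 (negPf c0) (negPf x0).
have [l pl] : exists l, root p l by apply/closed_rootP; rewrite gtn_eqF.
have [q pE] := factor_theorem p l pl.
have q0 : q != 0 by apply: contraNneq p0 => q0; rewrite pE q0 mul0r.
have [Tx|Tx] := eqVneq (T x - l *: x) 0.
  by exists l, x => //; apply/eqP; rewrite -subr_eq0 Tx.
apply: (IH q (T x - l *: x)) => //; last by rewrite -poly_actM -pE.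
move: sp; rewrite pE size_Mmonic ?monicXsubC// size_XsubC addn2/=.
by case.
Qed.

(** The [n + 1] vectors [x, T x, ..., T^n x] are linearly dependent, which gives
    a nonzero polynomial that kills [x]. *)
Lemma finite_dim_eigenvector n (f : {linear V -> 'rV[C]_n}) :
  (forall x, f x = 0 -> x = 0) -> (exists x : V, x != 0) ->
  exists l, exists2 y, y != 0 & T y = l *: y.
Proof.
move=> finj [x x0].
pose M : 'M[C]_(n.+1, n) := \matrix_(i < n.+1) f (iter i T x).
have : kermx M != 0.
  rewrite kermx_eq0 /row_free neq_ltn; apply/orP; left.
  by rewrite ltnS rank_leq_col.
move=> /rowV0Pn[w /sub_kermxP wM w0].
pose p := \poly_(i < n.+1) (w 0 (inord i)).
have pE (i : 'I_n.+1) : p`_i = w 0 i by rewrite coef_poly ltn_ord inord_val.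
apply: (@eigenvector_of_poly_act p x) => //.
  apply: contraNneq w0 => p0; apply/eqP/rowP => i.
  by rewrite -pE p0 coef0 mxE.
apply: finj; rewrite (poly_actE _ (size_poly _ _)) linear_sum -[RHS]wM.
rewrite mulmx_sum_row.
by apply: eq_bigr => i _; rewrite linearZ/= pE rowK.
Qed.

End FiniteDimension.

(** * The theorem *)

Theorem theorem1p1 (R : realType) (H : completeNormedModType R[i])
    (dot : {dot H for Num.conj})
    (dot_norm : forall x : H, `|x| = sqrtC (dot x x))
    (H_neq0 : exists x : H, x != 0)
    (H_separable : separable H) :
  nowhere_dense [set T : bounded_op H | point_spectrum T = set0].
Proof.
apply/seteqP; split => // T Tint.
have no_eigen (B : bounded_op H) (l : R[i]) x :
    point_spectrum B = set0 -> x != 0 -> B x = l *: x -> False.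
  move=> B0 x0 Bx; have : point_spectrum B l by apply/point_spectrumP; exists x.
  by rewrite B0.
have [Hinf|] := pselect (infinite_dim H); last first.
  move=> /existsNP[P /not_implyP[[n [f fP]] noP]].
  have Tcl : closure [set T : bounded_op H | point_spectrum T = set0] T.
    exact: interior_subset Tint.
  have [B [/= B0 _]] := Tcl setT filterT.
  have [|l [y y0 By]] := @finite_dim_eigenvector R[i] H B n f _ H_neq0.
    move=> x /fP Px; apply: contrapT => /eqP x0; apply: noP; by exists x.
  exact: no_eigen B0 y0 By.
have /nbhs_ballP[_ /pos_complexE[r r0 ->] rT] : nbhs T (closure
    [set T : bounded_op H | point_spectrum T = set0]) by [].
have [T' [l [e [e0 T'r T'e]]]] :=
  persistent_eigenvalue dot_norm T Hinf H_separable r0.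
have T'cl : closure [set T : bounded_op H | point_spectrum T = set0] T'.
  by apply: rT; rewrite -ball_normE/= distrC nrm_ltE.
have [|B [/= B0 Be]] := T'cl (ball T' e%:C).
  by apply: nbhsx_ballx; rewrite ltcR.
move: Be; rewrite -ball_normE/= distrC nrm_ltE => /T'e[x x0 Bx].
exact: no_eigen B0 x0 Bx.
Qed.
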